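(* Let $M$ be a smooth manifold endowed with a $(1,2)$-tensor field $c$ defining a commutative associative product $\circ$ on vector fields, $(X\circ Y)^i=c^i_{jk}X^jY^k$, and satisfying the Hertling–Manin condition. For any vector field $Z$ on $M$ let $V_Z$ be the $(1,1)$-tensor field $(V_Z)^i_j=c^i_{jk}Z^k$ (that is, $V_Z X=Z\circ X$). Then the Haantjes tensor $H_{V_Z}$ vanishes identically, for any choice of the vector field $Z$.
   Context: Sum over repeated indices is understood. The Hertling–Manin condition is: for all vector fields $X,Y,Z,W$, $$[X\circ Y,Z\circ W]-[X\circ Y,Z]\circ W-[X\circ Y,W]\circ Z-X\circ[Y,Z\circ W]+X\circ[Y,Z]\circ W+X\circ[Y,W]\circ Z-Y\circ[X,Z\circ W]+Y\circ[X,Z]\circ W+Y\circ[X,W]\circ Z=0 .$$ No unit for the product is assumed. For a $(1,1)$-tensor field $V$, the Nijenhuis tensor is $$N_V(X,Y)=[VX,VY]-V[X,VY]-V[VX,Y]+V^2[X,Y],$$ and the Haantjes tensor is $$H_V(X,Y)=N_V(VX,VY)-V\,N_V(X,VY)-V\,N_V(VX,Y)+V^2N_V(X,Y),$$ for arbitrary vector fields $X,Y$. *)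

(* Defs.v *)
From HB Require Import structures.
From mathcomp Require Import all_boot all_order all_algebra.
From mathcomp Require Import boolp classical_sets functions reals.
From mathcomp Require Import topology normedtype derive.

Set Implicit Arguments.
Unset Strict Implicit.
Unset Printing Implicit Defensive.

Import Order.TTheory GRing.Theory Num.Theory.
Import numFieldNormedType.Exports.

Local Open Scope classical_set_scope.
Local Open Scope ring_scope.

Section Smoothness.
Context {R : realType} {n : nat}.

Definition partial (j : 'I_n) (f : 'rV[R]_n -> R) : 'rV[R]_n -> R :=
  fun x => 'D_(delta_mx 0 j) f x.

(* Intended for open [U], so that [f] may take arbitrary values outside [U]. *)
Fixpoint Ck_on (k : nat) (U : set 'rV[R]_n) (f : 'rV[R]_n -> R) : Prop :=
  if k is k'.+1 then
    (forall x, U x -> differentiable f x) /\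
    (forall j, Ck_on k' U (partial j f))
  else forall x, U x -> {for x, continuous f}.

Definition smooth_on (U : set 'rV[R]_n) (f : 'rV[R]_n -> R) : Prop :=
  forall k, Ck_on k U f.

End Smoothness.

(* [chart_inv] is the inverse homeomorphism, extended arbitrarily outside of the
   open set [chart_fun @` chart_dom]. *)
Record chart (R : realType) (M : topologicalType) (n : nat) := Chart {
  chart_dom : set M;
  chart_fun : M -> 'rV[R]_n;
  chart_inv : 'rV[R]_n -> M;
  chart_dom_open : open chart_dom;
  chart_img_open : open (chart_fun @` chart_dom);
  chart_funK : forall p, chart_dom p -> chart_inv (chart_fun p) = p;
  chart_fun_continuous : {within chart_dom, continuous chart_fun};
  chart_inv_continuous :
    {within chart_fun @` chart_dom, continuous chart_inv} }.

Section Transition.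
Context {R : realType} {M : topologicalType} {n : nat}.
Implicit Types a b : chart R M n.

Definition chart_img a : set 'rV[R]_n := chart_fun a @` chart_dom a.

Definition overlap a b : set 'rV[R]_n :=
  chart_fun a @` (chart_dom a `&` chart_dom b).

Definition transition a b : 'rV[R]_n -> 'rV[R]_n :=
  chart_fun b \o chart_inv a.

(* With coordinates x on [a] and y on [b]: the matrix of the dy^i / dx^j. *)
Definition jac a b (x : 'rV[R]_n) : 'M[R]_n :=
  \matrix_(i, j) partial j (fun y => transition a b y 0 i) x.

End Transition.

Record smooth_manifold (R : realType) (n : nat) := SmoothManifold {
  mcarrier :> topologicalType;
  m_hausdorff : hausdorff_space mcarrier;
  m_second_countable : @second_countable mcarrier;
  atlas : set (chart R mcarrier n);
  atlas_cover : forall p : mcarrier, exists2 a, atlas a & chart_dom a p;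
  atlas_smooth : forall a b, atlas a -> atlas b ->
    forall i : 'I_n, smooth_on (overlap a b) (fun x => transition a b x 0 i) }.

Section Tensors.
Context {R : realType} {n : nat} (M : smooth_manifold R n).

(* Fields are families of components, one for each chart, written in the
   coordinates of that chart.  Only the components in charts [a] of the atlas, at
   points of [chart_img a], are meaningful; [field_eq] compares just these. *)
Definition field10 := chart R M n -> 'rV[R]_n -> 'rV[R]_n.

(* [V a x i j] is V^i_j. *)
Definition field11 := chart R M n -> 'rV[R]_n -> 'M[R]_n.

(* [c a x i j k] is c^i_{jk}. *)
Definition field12 := chart R M n -> 'rV[R]_n -> 'I_n -> 'I_n -> 'I_n -> R.

Definition field_eq (X Y : field10) : Prop :=
  forall a, atlas a -> forall x, chart_img a x -> X a x = Y a x.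

Definition vector_field (X : field10) : Prop :=
  (forall a, atlas a ->
     forall i, smooth_on (chart_img a) (fun x => X a x 0 i)) /\
  (forall a b, atlas a -> atlas b -> forall x, overlap a b x -> forall i,
     X b (transition a b x) 0 i = \sum_l jac a b x i l * X a x 0 l).

Definition tensor12 (c : field12) : Prop :=
  (forall a, atlas a ->
     forall i j k, smooth_on (chart_img a) (fun x => c a x i j k)) /\
  (forall a b, atlas a -> atlas b -> forall x, overlap a b x -> forall i j k,
     c b (transition a b x) i j k =
       \sum_l \sum_p \sum_q
         jac a b x i l * jac b a (transition a b x) p j
         * jac b a (transition a b x) q k * c a x l p q).

Definition bracket (X Y : field10) : field10 := fun a x =>
  \row_i \sum_j (X a x 0 j * partial j (fun y => Y a y 0 i) x
                 - Y a x 0 j * partial j (fun y => X a y 0 i) x).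

Definition tprod (c : field12) (X Y : field10) : field10 := fun a x =>
  \row_i \sum_j \sum_k c a x i j k * X a x 0 j * Y a x 0 k.

Definition app11 (V : field11) (X : field10) : field10 := fun a x =>
  \row_i \sum_j V a x i j * X a x 0 j.

Definition mult_tensor (c : field12) (Z : field10) : field11 := fun a x =>
  \matrix_(i, j) \sum_k c a x i j k * Z a x 0 k.

Definition commutative_product (c : field12) : Prop :=
  forall X Y, vector_field X -> vector_field Y ->
    field_eq (tprod c X Y) (tprod c Y X).

Definition associative_product (c : field12) : Prop :=
  forall X Y Z, vector_field X -> vector_field Y -> vector_field Z ->
    field_eq (tprod c X (tprod c Y Z)) (tprod c (tprod c X Y) Z).

(* Sums of fields are taken pointwise, in the function space [field10]. *)
Definition hertling_manin (c : field12) : Prop :=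
  let: m := tprod c in
  forall X Y Z W, vector_field X -> vector_field Y ->
    vector_field Z -> vector_field W ->
    field_eq
      (bracket (m X Y) (m Z W)
       - m (bracket (m X Y) Z) W - m (bracket (m X Y) W) Z
       - m X (bracket Y (m Z W)) + m (m X (bracket Y Z)) W
       + m (m X (bracket Y W)) Z
       - m Y (bracket X (m Z W)) + m (m Y (bracket X Z)) W
       + m (m Y (bracket X W)) Z)
      0.

Definition nijenhuis (V : field11) (X Y : field10) : field10 :=
  let: v := app11 V in
  bracket (v X) (v Y) - v (bracket X (v Y)) - v (bracket (v X) Y)
  + v (v (bracket X Y)).

Definition haantjes (V : field11) (X Y : field10) : field10 :=
  let: v := app11 V in
  nijenhuis V (v X) (v Y) - v (nijenhuis V X (v Y)) - v (nijenhuis V (v X) Y)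
  + v (v (nijenhuis V X Y)).

End Tensors.

(* Main.v *)
Require Import Defs.
From mathcomp Require Import all_boot all_order all_algebra.
From mathcomp Require Import boolp classical_sets functions reals.
From mathcomp Require Import topology normedtype landau derive ring lra.

(** Write [V X = X o Z], and for a vector field [X] put
    [P X = [Z, X o Z] - [Z, X] o Z].

    The whole content of the Hertling-Manin identity that is needed is its
    instance at [(X, Z; Y, Z)].  It expresses [[X o Z, Y o Z]] through brackets
    multiplied by [X], [Y] or [Z]; substituting it in the Nijenhuis tensor of
    [V], the terms with [[X, Y]], [[X, Y o Z]] and [[X o Z, Y]] cancel, the term
    with [[Z, Z]] vanishes, and there remains
      [N_V (X, Y) = X o P Y - Y o P X]
    ([nijenhuis_mult_tensor]).  The Haantjes tensor is the alternating sum of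
    the [V]-images of [N_V] at [X] or [V X] and [Y] or [V Y].  In a commutative
    associative algebra [V X o P Y = V (X o P Y)], so each of the terms
    [X o P Y], [X o P (V Y)], [Y o P X] and [Y o P (V X)], multiplied by a power
    of [Z], occurs twice with opposite signs, and [H_V = 0]
    ([haantjes_mult_tensor]).

    This computation multiplies brackets by vector fields, whereas
    commutativity, associativity and the Hertling-Manin identity are assumed
    for vector fields only.  One therefore has to know that vector fields are
    stable under differences, under the product, and under the bracket.
    Smoothness follows from the sum and product rules.  The transformation rule
    of a bracket between two charts follows from the chain rule: the derivative
    of [Y] along [X] transforms like a vector up to a term which contracts [X]
    and [Y] with the Hessian of the coordinate change, and this term is
    symmetric in [X] and [Y] because partial derivatives commute
    ([deriveC]). *)

Set Implicit Arguments.
Unset Strict Implicit.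
Unset Printing Implicit Defensive.

Import Order.TTheory GRing.Theory Num.Theory.
Import numFieldNormedType.Exports.

Local Open Scope classical_set_scope.
Local Open Scope ring_scope.

(** * Symmetry of second derivatives *)

Section SecondDerivatives.
Context {R : realType} {V : normedModType R}.
Implicit Types (f : V -> R) (x y u v : V) (U : set V).

Lemma is_derive_translate f x u w (l : R) :
  is_derive (x + w) u f l -> is_derive x u (f \o shift w) l.
Proof.
have E : (fun h : R => h^-1 *: (((f \o shift w) \o shift x) (h *: u)
      - (f \o shift w) x)) =
    (fun h : R => h^-1 *: ((f \o shift (x + w)) (h *: u) - f (x + w))).
  by apply/funext => h /=; congr (_ *: (f _ - _)); rewrite -addrA.
by case=> df Df; apply: DeriveDef; rewrite /derivable /derive E;
  [exact: df|exact: Df].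
Qed.

Lemma is_derive_line f y u (t : R) : derivable f (y + t *: u) u ->
  is_derive t 1 (fun s : R => f (y + s *: u)) ('D_u f (y + t *: u)).
Proof.
move=> df.
have E : (fun h : R => h^-1 *: (((fun s : R => f (y + s *: u)) \o shift t)
      (h *: (1 : R)) - f (y + t *: u))) =
    (fun h : R => h^-1 *: ((f \o shift (y + t *: u)) (h *: u)
      - f (y + t *: u))).
  apply/funext => h /=; congr (_ *: (f _ - _)).
  by rewrite [_%:A]mulr1 scalerDl addrCA.
by split; [rewrite /derivable E | rewrite /derive E].
Qed.

Lemma MVT_line f y u (h : R) : 0 < h ->
  (forall t, 0 <= t <= h -> derivable f (y + t *: u) u) ->
  exists2 t, 0 <= t <= h & f (y + h *: u) - f y = h * 'D_u f (y + t *: u).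
Proof.
move=> h0 df.
pose F (s : R) := f (y + s *: u); pose dF (s : R) := 'D_u f (y + s *: u).
have FdF (t : R) : t \in `[0, h] -> is_derive t 1 F (dF t).
  by move=> th; apply: is_derive_line; apply: df; rewrite in_itv in th.
have FdF' (t : R) : t \in `]0, h[ -> is_derive t 1 F (dF t).
  by move=> th; apply: FdF; exact: subset_itv_oo_cc.
have Fcont : {within `[0, h], continuous F}.
  by apply: derivable_within_continuous => t /FdF [].
have [t th E] := MVT h0 FdF' Fcont.
exists t; first by move: (subset_itv_oo_cc th); rewrite in_itv.
by move: E; rewrite /F /dF scale0r addr0 subr0 mulrC.
Qed.

(** Applying the mean value theorem in the direction [u] to the increment
    [z |-> f (z + h v) - f z], and then in the direction [v] to ['D_u f].  The
    left-hand side is symmetric in [u] and [v]. *)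
Lemma second_difference f x u v (h : R) : 0 < h ->
  (forall s t, 0 <= s <= h -> 0 <= t <= h ->
     derivable f (x + s *: u + t *: v) u /\
     derivable ('D_u f) (x + s *: u + t *: v) v) ->
  exists s t, [/\ 0 <= s <= h, 0 <= t <= h &
    f (x + h *: u + h *: v) - f (x + h *: u) - f (x + h *: v) + f x =
    h ^+ 2 * 'D_v ('D_u f) (x + s *: u + t *: v)].
Proof.
move=> h0 df.
have hh : 0 <= h <= h by rewrite lexx ltW.
have h0' : 0 <= (0 : R) <= h by rewrite lexx ltW.
pose g z := f (z + h *: v) - f z.
have dg s : 0 <= s <= h -> is_derive (x + s *: u) u g
    ('D_u f (x + s *: u + h *: v) - 'D_u f (x + s *: u)).
  move=> sh; have [d1 _] := df s h sh hh.
  have [d2 _] := df s 0 sh h0'; rewrite scale0r addr0 in d2.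
  have -> : g = (f \o shift (h *: v)) - f by apply/funext.
  apply: is_deriveB; last exact: derivableP.
  exact: is_derive_translate (derivableP d1).
have [s sh Es] : exists2 s, 0 <= s <= h &
    g (x + h *: u) - g x = h * 'D_u g (x + s *: u).
  apply: (@MVT_line g x u h h0) => s sh; have [d _] := dg s sh; exact: d.
have [t th Et] : exists2 t, 0 <= t <= h &
    'D_u f (x + s *: u + h *: v) - 'D_u f (x + s *: u) =
    h * 'D_v ('D_u f) (x + s *: u + t *: v).
  apply: (@MVT_line ('D_u f) (x + s *: u) v h h0) => t th.
  have [_ d] := df s t sh th; exact: d.
exists s, t; split => //.
have [_ Dg] := dg s sh.
rewrite expr2 -mulrA -Et -Dg -Es /g; ring.
Qed.

(** The second difference of [f] at scale [h], divided by [h ^ 2], is a value of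
    ['D_v ('D_u f)] and also a value of ['D_u ('D_v f)], at two points which
    tend to [x] with [h]; both mixed derivatives being continuous at [x], they
    agree there. *)
Lemma deriveC f x u v :
  (\near x, [/\ derivable f x u, derivable f x v,
     derivable ('D_u f) x v & derivable ('D_v f) x u]) ->
  {for x, continuous ('D_v ('D_u f))} -> {for x, continuous ('D_u ('D_v f))} ->
  'D_v ('D_u f) x = 'D_u ('D_v f) x.
Proof.
move=> df cuv cvu; apply/eqP; rewrite -subr_eq0 -normr_le0.
apply/ler_addgt0Pl => e e0; rewrite addr0.
have e2 : 0 < e / 2 by rewrite divr_gt0.
move/cvgrPdist_lt : cuv => /(_ _ e2) nuv.
move/cvgrPdist_lt : cvu => /(_ _ e2) nvu.
have [d /= d0 B] := (nbhs_normP _ _).1 (filterI df (filterI nuv nvu)).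
have B0 z : `|x - z| < d -> [/\ derivable f z u, derivable f z v,
    derivable ('D_u f) z v & derivable ('D_v f) z u].
  by move=> /B [].
have B1 z : `|x - z| < d ->
    `|'D_v ('D_u f) x - 'D_v ('D_u f) z| < e / 2.
  by move=> /B [_ [? _]].
have B2 z : `|x - z| < d ->
    `|'D_u ('D_v f) x - 'D_u ('D_v f) z| < e / 2.
  by move=> /B [_ [_ ?]].
clear B df nuv nvu.
(* This [h] keeps the whole parallelogram spanned by [h *: u] and [h *: v] at
   [x] inside the ball of radius [d]; the summand 1 covers [u = v = 0]. *)
pose h := d / 2 / (`|u| + `|v| + 1).
have w0 : 0 < `|u| + `|v| + 1 by rewrite ltr_wpDl ?addr_ge0.
have h0 : 0 < h by rewrite !divr_gt0.
have hB (s t : R) : 0 <= s <= h -> 0 <= t <= h ->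
    `|x - (x + s *: u + t *: v)| < d.
  move=> /andP[s0 sh] /andP[t0 th].
  rewrite -addrA opprD addNKr normrN.
  apply: le_lt_trans (ler_normD _ _) _; rewrite !normrZ !ger0_norm//.
  apply: (@le_lt_trans _ _ (h * (`|u| + `|v| + 1))).
    rewrite !mulrDr mulr1 -addrA lerD ?ler_wpM2r//.
    by rewrite ler_wpDr ?ler_wpM2r// ltW.
  by rewrite /h divfK ?gt_eqF// ltr_pdivrMr// ltr_pMr// ltr1n.
have [|s [t [sh th E]]] := @second_difference f x u v h h0.
  move=> s t sh th; have [d1 _ d3 _] := B0 _ (hB s t sh th).
  exact: (conj d1 d3).
have [|t' [s' [th' sh' E']]] := @second_difference f x v u h h0.
  move=> k l kh lh; rewrite addrAC.
  have [_ d2 _ d4] := B0 _ (hB l k lh kh).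
  exact: (conj d2 d4).
have {}B1 := B1 _ (hB s t sh th).
have {}B2 := B2 _ (hB s' t' sh' th').
have EE : 'D_v ('D_u f) (x + s *: u + t *: v) =
    'D_u ('D_v f) (x + s' *: u + t' *: v).
  apply: (mulfI (lt0r_neq0 (exprn_gt0 2 h0))); rewrite [x + s' *: u + _]addrAC.
  apply: (etrans (esym E)); apply: etrans E'.
  by rewrite [x + h *: v + _]addrAC [_ - f (x + h *: u) - _]addrAC.
rewrite EE in B1; move: B1 B2.
move: ('D_u ('D_v f) (x + s' *: u + t' *: v)) => q.
move: ('D_v ('D_u f) x) ('D_u ('D_v f) x) => a b aq bq.
rewrite -(subrKA q) [e]splitr; apply: le_trans (ler_normD _ _) _.
by rewrite distrC in bq; exact: (lerD (ltW aq) (ltW bq)).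
Qed.

End SecondDerivatives.

(** * Smooth functions on open sets *)

Lemma near_eq_differentiable (R : numFieldType) (V W : normedModType R)
    (f g : V -> W) (x : V) :
  {near x, f =1 g} -> differentiable f x -> differentiable g x.
Proof.
move=> fg /[dup] /diff_continuous dfc /diff_locally dfx.
have dgx : g \o shift x = cst (g x) + 'd f x +o_ 0 id.
  apply/eqaddoP => e e0.
  move/eqaddoP : dfx => /(_ e e0).
  have fg0 : \forall h \near (0 : V), f (h + x) = g (h + x).
    have := fg; rewrite [X in X -> _](near_shift 0 x (fun y => f y = g y)).
    by rewrite subr0.
  have fgx : f x = g x := nbhs_singleton fg.
  apply: filterS2 fg0 => h fgh /=.
  by rewrite /= !fctE /= fgh fgx.
(* ['d g x] is a choice among the linear maps that approximate [g] at [x], and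
   ['d f x] is one of them. *)
have Dg : 'd g x = 'd f x :> (V -> W) by apply: diff_unique.
by apply/diff_locallyP; rewrite Dg.
Qed.

Section SmoothFunctions.
Context {R : realType} {n : nat}.
Implicit Types (U : set 'rV[R]_n) (f g : 'rV[R]_n -> R).

Lemma open_near_eq U f g : open U -> (forall x, U x -> f x = g x) ->
  forall x, U x -> {near x, f =1 g}.
Proof.
move=> oU fg x Ux; near=> y.
by apply: fg; near: y; exact: open_nbhs_nbhs.
Unshelve. all: by end_near. Qed.

(** The product rule for partial derivatives holds on [U] only, so the inductive
    steps below need that [Ck_on] ignores the values outside [U]. *)
Lemma eq_Ck_on k U f g : open U -> (forall x, U x -> f x = g x) ->
  Ck_on k U f -> Ck_on k U g.
Proof.
move=> oU; elim: k f g => [|k IH] f g fg /=.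
  move=> cf x Ux; suff : g y @[y --> x] --> g x by [].
  rewrite -fg//; apply: cvg_trans (cf x Ux).
  exact: near_eq_cvg (open_near_eq oU fg Ux).
move=> [df pf]; split=> [x Ux|j].
  exact: near_eq_differentiable (open_near_eq oU fg Ux) (df x Ux).
apply: IH (pf j) => x Ux.
exact: near_eq_derive (open_near_eq oU fg Ux).
Qed.

Lemma Ck_onW k U f : Ck_on k.+1 U f -> Ck_on k U f.
Proof.
elim: k f => [|k IH] f [df pf].
  by move=> x /df; apply: differentiable_continuous.
by split=> // j; apply: IH; exact: pf.
Qed.

Lemma Ck_on_cst k U (r : R) : open U -> Ck_on k U (fun=> r).
Proof.
move=> oU; elim: k r => [|k IH] r /=.
  by move=> x _; exact: cst_continuous.
split=> [x _|j]; first exact: differentiable_cst.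
apply: eq_Ck_on (IH 0) => // x _.
by rewrite /partial derive_cst.
Qed.

Lemma Ck_onD k U f g : open U -> Ck_on k U f -> Ck_on k U g ->
  Ck_on k U (fun x => f x + g x).
Proof.
move=> oU; elim: k f g => [|k IH] f g /=.
  by move=> cf cg x Ux; apply: continuousD; [exact: cf|exact: cg].
move=> [df pf] [dg pg]; split=> [x Ux|j].
  by apply: differentiableD; [exact: df|exact: dg].
apply: eq_Ck_on (IH _ _ (pf j) (pg j)) => // x Ux.
apply/esym; apply: deriveD; apply: diff_derivable; [exact: df|exact: dg].
Qed.

Lemma Ck_onM k U f g : open U -> Ck_on k U f -> Ck_on k U g ->
  Ck_on k U (fun x => f x * g x).
Proof.
move=> oU; elim: k f g => [|k IH] f g.
  by move=> cf cg x Ux; apply: continuousM; [exact: cf|exact: cg].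
move=> Cf Cg; have [df pf] := Cf; have [dg pg] := Cg; split=> [x Ux|j].
  by apply: differentiableM; [exact: df|exact: dg].
apply: eq_Ck_on (Ck_onD oU (IH _ _ (Ck_onW Cf) (pg j))
  (IH _ _ (Ck_onW Cg) (pf j))) => // x Ux.
apply/esym; apply: deriveM; apply: diff_derivable; [exact: df|exact: dg].
Qed.

Lemma smooth_onM U f g : open U -> smooth_on U f -> smooth_on U g ->
  smooth_on U (fun x => f x * g x).
Proof. by move=> oU sf sg k; exact: Ck_onM. Qed.

Lemma smooth_onB U f g : open U -> smooth_on U f -> smooth_on U g ->
  smooth_on U (fun x => f x - g x).
Proof.
move=> oU sf sg k; apply: Ck_onD => //.
apply: (@eq_Ck_on _ _ (fun x => -1 * g x)) => //.
  by move=> x _; rewrite mulN1r.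
by apply: Ck_onM => //; exact: Ck_on_cst.
Qed.

Lemma smooth_on_sum U (I : Type) (r : seq I) (P : pred I)
    (F : I -> 'rV[R]_n -> R) : open U -> (forall i, smooth_on U (F i)) ->
  smooth_on U (fun x => \sum_(i <- r | P i) F i x).
Proof.
move=> oU sF; elim: r => [|i r IH] k.
  by apply: eq_Ck_on (Ck_on_cst k 0 oU) => // x _; rewrite big_nil.
have [Pi|nPi] := boolP (P i).
  by apply: eq_Ck_on (Ck_onD oU (sF i k) (IH k)) => // x _; rewrite big_cons Pi.
by apply: eq_Ck_on (IH k) => // x _; rewrite big_cons (negbTE nPi).
Qed.

Lemma smooth_on_partial U f j : smooth_on U f -> smooth_on U (partial j f).
Proof. by move=> sf k; have [_] := sf k.+1; apply. Qed.

Lemma smooth_on_differentiable U f x :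
  smooth_on U f -> U x -> differentiable f x.
Proof. by move=> sf; have [df _] := sf 1; exact: df. Qed.

Lemma partialC U f i j x : open U -> smooth_on U f -> U x ->
  partial i (partial j f) x = partial j (partial i f) x.
Proof.
move=> oU sf Ux; apply: deriveC; last 2 first.
- by have [_ /(_ j) [_ /(_ i)]] := sf 2; apply.
- by have [_ /(_ i) [_ /(_ j)]] := sf 2; apply.
have U' := open_nbhs_nbhs (conj oU Ux).
apply: filterS U' => y Uy.
have df k := smooth_on_differentiable (smooth_on_partial k sf) Uy.
split; apply: diff_derivable; [| | exact: df j|exact: df i].
  exact: smooth_on_differentiable sf Uy.
exact: smooth_on_differentiable sf Uy.
Qed.

Lemma chain_rule m (phi : 'rV[R]_n -> 'rV[R]_m) (g : 'rV[R]_m -> R) x j :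
  (forall i, differentiable (fun y => phi y 0 i) x) ->
  differentiable g (phi x) ->
  partial j (g \o phi) x =
  \sum_i partial i g (phi x) * partial j (fun y => phi y 0 i) x.
Proof.
move=> dphi dg.
have Ephi : phi = \sum_i (fun y => phi y 0 i *: delta_mx 0 i).
  by apply/funext => y; rewrite fct_sumE [LHS]row_sum_delta.
have df : differentiable phi x.
  by rewrite Ephi; apply: differentiable_sum => i; apply: differentiableZl.
rewrite /partial deriveE; last exact: differentiable_comp.
rewrite diff_comp//= -[_ (delta_mx 0 j)](deriveE _ df).
rewrite derive_mx; last exact: diff_derivable.
rewrite [X in 'd g _ X]row_sum_delta linear_sum.
apply: eq_bigr => i _; rewrite linearZ /= deriveE// mulrC; congr (_ * _).
by rewrite !mxE.
Qed.

End SmoothFunctions.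

(** * Changes of coordinates *)

Lemma partial_sumM (R : realType) (n : nat) (I : finType)
    (F G : I -> 'rV[R]_n -> R) x j :
  (forall i, differentiable (F i) x) -> (forall i, differentiable (G i) x) ->
  partial j (fun z => \sum_i F i z * G i z) x =
  \sum_i (F i x * partial j (G i) x + G i x * partial j (F i) x).
Proof.
move=> dF dG; rewrite /partial.
have -> : (fun z => \sum_i F i z * G i z) =
    \sum_(k < #|I|) (F (enum_val k) * G (enum_val k)).
  apply/funext => z; rewrite fct_sumE (reindex (@enum_val I predT))//=.
  exact/onW_bij/enum_val_bij.
rewrite derive_sum => [|k]; last first.
  by apply: derivableM; apply: diff_derivable.
rewrite [RHS](reindex (@enum_val I predT))/=; last exact/onW_bij/enum_val_bij.
by apply: eq_bigr => k _; rewrite deriveM//; apply: diff_derivable.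
Qed.

Section Overlaps.
Context {R : realType} {M : topologicalType} {n : nat}.
Implicit Types a b : chart R M n.

Lemma open_overlap a b : open (overlap a b).
Proof.
have -> : overlap a b = chart_img a `&` chart_inv a @^-1` chart_dom b.
  rewrite eqEsubset; split=> [_ [p [ap bp] <-]|_ [[p ap <-]]].
    by split; [exists p|rewrite /= chart_funK].
  by rewrite /= chart_funK// => bp; exists p.
have := @chart_inv_continuous _ _ _ a.
rewrite continuous_open_subspace; last exact: chart_img_open.
move/(continuous_inP _ (@chart_img_open _ _ _ a)); apply.
exact: chart_dom_open.
Qed.

Lemma overlap_img a b x : overlap a b x -> chart_img a x.
Proof. by case=> p [ap _] <-; exists p. Qed.

Lemma transition_overlap a b x : overlap a b x ->
  overlap b a (transition a b x).
Proof.
by case=> p [ap bp] <-; exists p => //; rewrite /transition /= chart_funK.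
Qed.

Lemma transitionK a b x : overlap a b x ->
  transition b a (transition a b x) = x.
Proof. by case=> p [ap bp] <-; rewrite /transition /= !chart_funK. Qed.

End Overlaps.

Section VectorFields.
Context {R : realType} {n : nat} (M : smooth_manifold R n).
Implicit Types (X Y Z : field10 M) (c : field12 M) (a b : chart R M n).

Lemma vector_fieldB X Y : vector_field X -> vector_field Y ->
  vector_field (X - Y).
Proof.
move=> [sX tX] [sY tY]; split=> [a aA i|a b aA bA x xab i].
  have -> : (fun x => (X - Y) a x 0 i) = (fun x => X a x 0 i - Y a x 0 i).
    by apply/funext => x; rewrite !mxE.
  by apply: smooth_onB; [exact: chart_img_open|exact: sX|exact: sY].
rewrite !mxE tX// tY// -sumrB; apply: eq_bigr => l _.
by rewrite !mxE mulrBr.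
Qed.

Lemma exchange_big3 (F : 'I_n -> 'I_n -> 'I_n -> R) :
  \sum_j \sum_k \sum_l F j k l = \sum_l \sum_j \sum_k F j k l.
Proof.
rewrite [RHS]exchange_big; apply: eq_bigr => j _; exact: exchange_big.
Qed.

(** The covariant indices of [c] contract with the inverse Jacobian.  The
    transformation rules of [X] and [Y] read backwards, from [b] to [a], absorb
    it: they give the components in [a] as the inverse Jacobian applied to those
    in [b]. *)
Lemma vector_field_tprod c X Y : tensor12 c ->
  vector_field X -> vector_field Y -> vector_field (tprod c X Y).
Proof.
move=> [sc tc] [sX tX] [sY tY]; split=> [a aA i|a b aA bA x xab i].
  have -> : (fun x => tprod c X Y a x 0 i) =
      (fun x => \sum_j \sum_k c a x i j k * X a x 0 j * Y a x 0 k).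
    by apply/funext => x; rewrite mxE.
  have oU := @chart_img_open _ _ _ a.
  apply: smooth_on_sum => // j; apply: smooth_on_sum => // k.
  apply: (smooth_onM oU _ (sY a aA k)).
  exact: smooth_onM oU (sc a aA i j k) (sX a aA j).
set y := transition a b x; have yba := transition_overlap xab.
have XE l : X a x 0 l = \sum_j jac b a y l j * X b y 0 j.
  by rewrite -(tX b a) ?transitionK.
have YE l : Y a x 0 l = \sum_j jac b a y l j * Y b y 0 j.
  by rewrite -(tY b a) ?transitionK.
rewrite mxE; under eq_bigr => j _ do under eq_bigr => k _ do
  (rewrite tc// -mulrA mulr_suml; under eq_bigr => l _ do
    (rewrite mulr_suml; under eq_bigr => p _ do rewrite mulr_suml)).
rewrite exchange_big3; apply: eq_bigr => l _.
rewrite exchange_big3 [tprod _ _ _ _ _ _ _]mxE mulr_sumr; apply: eq_bigr => p _.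

rewrite exchange_big3 mulr_sumr; apply: eq_bigr => q _.
rewrite XE YE -mulrA big_distrlr /= !mulr_sumr; apply: eq_bigr => j _.
rewrite !mulr_sumr; apply: eq_bigr => k _; rewrite -/y; ring.
Qed.

(** The obstruction to transforming the derivative of [Y] along [X] as a vector
    is the contraction of the Hessian of the coordinate change with [X] and
    [Y].  It comes from differentiating, with the chain rule on the left and the
    product rule on the right, the transformation rule of [Y] on the overlap. *)
Lemma directional_derivative_transition X Y a b x i :
  vector_field X -> vector_field Y -> atlas a -> atlas b -> overlap a b x ->
  \sum_m X b (transition a b x) 0 m *
    partial m (fun y => Y b y 0 i) (transition a b x) =
  (\sum_j \sum_l
     partial j (partial l (fun y => transition a b y 0 i)) x
       * (X a x 0 j * Y a x 0 l)) +
  \sum_l jac a b x i l *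
    \sum_j X a x 0 j * partial j (fun y => Y a y 0 l) x.
Proof.
move=> [_ tX] [sY tY] aA bA xab.
have oU := @open_overlap _ _ _ a b.
have sphi k := atlas_smooth aA bA k.
have dY j : \sum_m partial m (fun y => Y b y 0 i) (transition a b x)
      * jac a b x m j =
    \sum_l (jac a b x i l * partial j (fun y => Y a y 0 l) x +
      Y a x 0 l * partial j (partial l (fun y => transition a b y 0 i)) x).
  under eq_bigr do rewrite mxE.
  rewrite -(@chain_rule _ _ _ (transition a b) (fun y => Y b y 0 i));
    first last.
  - apply: (smooth_on_differentiable (sY b bA i)).
    exact: overlap_img (transition_overlap xab).
  - by move=> k; exact: smooth_on_differentiable (sphi k) xab.
  have E : {near x, (fun y => Y b y 0 i) \o transition a b =1
      (fun z => \sum_l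
         partial l (fun y => transition a b y 0 i) z * Y a z 0 l)}.
    apply: (open_near_eq oU) xab => z zab /=; rewrite tY//.
    by apply: eq_bigr => l _; rewrite mxE.
  rewrite /partial (near_eq_derive _ E) -/(partial _ _ _) partial_sumM.
  - by apply: eq_bigr => l _; rewrite mxE.
  - move=> l.
    exact: smooth_on_differentiable (smooth_on_partial l (sphi i)) xab.
  - by move=> l; apply: smooth_on_differentiable (sY a aA l) (overlap_img xab).
under eq_bigr => m _ do rewrite tX// mulr_suml.
rewrite exchange_big /=.
under eq_bigr => j _.
  under eq_bigr => m _ do rewrite mulrAC mulrC [jac a b x m j * _]mulrC.
  rewrite -mulr_sumr dY mulr_sumr.
  under eq_bigr => l _ do rewrite mulrDr addrC.
  rewrite big_split.
  over.
rewrite big_split /=; congr (_ + _).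
  by apply: eq_bigr => j _; apply: eq_bigr => l _; ring.
rewrite exchange_big; apply: eq_bigr => l _.
by rewrite mulr_sumr; apply: eq_bigr => j _; ring.
Qed.

(** In the antisymmetrized derivative the two Hessian terms cancel. *)
Lemma vector_field_bracket X Y : vector_field X -> vector_field Y ->
  vector_field (bracket X Y).
Proof.
move=> vX vY; have [[sX tX] [sY tY]] := (vX, vY).
split=> [a aA i|a b aA bA x xab i].
  have -> : (fun x => bracket X Y a x 0 i) =
      (fun x => \sum_j (X a x 0 j * partial j (fun y => Y a y 0 i) x
                 - Y a x 0 j * partial j (fun y => X a y 0 i) x)).
    by apply/funext => x; rewrite mxE.
  have oU := @chart_img_open _ _ _ a.
  apply: smooth_on_sum => // j.
  apply: smooth_onB => //; apply: smooth_onM => //.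
  - exact: sX.
  - exact: smooth_on_partial (sY _ _ _).
  - exact: sY.
  - exact: smooth_on_partial (sX _ _ _).
have oU := @open_overlap _ _ _ a b.
rewrite mxE sumrB !(@directional_derivative_transition _ _ a)//.
rewrite [X in X + _ - _]exchange_big opprD addrACA.
under [X in X - _ + _]eq_bigr => l _ do under eq_bigr => j _ do
  rewrite (partialC _ _ oU (atlas_smooth aA bA i) xab) [X a x 0 _ * _]mulrC.
rewrite subrr add0r -sumrB; apply: eq_bigr => l _.
by rewrite [bracket _ _ _ _ _ _]mxE sumrB mulrBr.
Qed.

End VectorFields.

(** * The Haantjes tensor of a multiplication operator *)

Section Haantjes.
Context {R : realType} {n : nat} (M : smooth_manifold R n).
Implicit Types (X Y Z W : field10 M).

Lemma bracketC X Y : bracket X Y = - bracket Y X.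
Proof.
apply/funext => a; apply/funext => x; apply/rowP => i.
by rewrite !mxE -sumrN; apply: eq_bigr => j _; rewrite opprB.
Qed.

Lemma bracketxx X : bracket X X = 0.
Proof.
apply/funext => a; apply/funext => x; apply/rowP => i.
by rewrite !mxE; apply: big1 => j _; rewrite subrr.
Qed.

Context (c : field12 M).

(** The algebra structure of a single tangent space: working with it lets the
    final computations take place among the values of the fields at a point. *)
Definition mul_at (a : chart R M n) (x u v : 'rV[R]_n) : 'rV[R]_n :=
  \row_i \sum_j \sum_k c a x i j k * u 0 j * v 0 k.

Lemma mul_atBl a x u v w :
  mul_at a x (u - v) w = mul_at a x u w - mul_at a x v w.
Proof.
apply/rowP => i; rewrite !mxE -sumrB; apply: eq_bigr => j _.
by rewrite -sumrB; apply: eq_bigr => k _; rewrite !mxE; ring.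
Qed.

Lemma mul_atBr a x u v w :
  mul_at a x u (v - w) = mul_at a x u v - mul_at a x u w.
Proof.
apply/rowP => i; rewrite !mxE -sumrB; apply: eq_bigr => j _.
by rewrite -sumrB; apply: eq_bigr => k _; rewrite !mxE; ring.
Qed.

Lemma mul_at0 a x u : mul_at a x u 0 = 0.
Proof. by have := mul_atBr a x u 0 0; rewrite !subrr. Qed.

Lemma mul_0at a x u : mul_at a x 0 u = 0.
Proof. by have := mul_atBl a x 0 0 u; rewrite !subrr. Qed.

Lemma tprodE X Y a x : tprod c X Y a x = mul_at a x (X a x) (Y a x).
Proof. by []. Qed.

Lemma app11_mult_tensor Z X : app11 (mult_tensor c Z) X = tprod c X Z.
Proof.
apply/funext => a; apply/funext => x; apply/rowP => i; rewrite !mxE.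
apply: eq_bigr => j _; rewrite mxE mulr_suml.
by apply: eq_bigr => k _; rewrite mulrAC.
Qed.

Context (c_tensor : tensor12 c) (c_comm : commutative_product c)
  (c_assoc : associative_product c) (c_HM : hertling_manin c).

Lemma tprodAC X Y Z : vector_field X -> vector_field Y -> vector_field Z ->
  field_eq (tprod c (tprod c X Y) Z) (tprod c (tprod c X Z) Y).
Proof.
move=> vX vY vZ a aA x xa.
rewrite -!(c_assoc _ _ _ aA xa)// ![tprod c X _ a x]tprodE.
by rewrite (c_comm vY vZ aA xa).
Qed.

(** The failure of [[Z, _]] to commute with multiplication by [Z].  It would be
    [X o [Z, Z] = 0] if [[Z, _]] were a derivation of the product, which the
    Hertling-Manin identity does not require. *)
Definition defect Z X : field10 M :=
  bracket Z (tprod c X Z) - tprod c (bracket Z X) Z.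

Lemma vector_field_defect Z X : vector_field Z -> vector_field X ->
  vector_field (defect Z X).
Proof.
move=> vZ vX; apply: vector_fieldB.
  by apply: vector_field_bracket => //; exact: vector_field_tprod.
by apply: vector_field_tprod => //; exact: vector_field_bracket.
Qed.

(** Solve the Hertling-Manin identity at [(X, Z; Y, Z)] for the bracket of
    [X o Z] and [Y o Z]. *)
Lemma nijenhuis_mult_tensor Z X Y :
  vector_field Z -> vector_field X -> vector_field Y ->
  field_eq (nijenhuis (mult_tensor c Z) X Y)
    (tprod c X (defect Z Y) - tprod c Y (defect Z X)).
Proof.
move=> vZ vX vY a aA x xa.
have vXZ := vector_field_tprod c_tensor vX vZ.
have vYZ := vector_field_tprod c_tensor vY vZ.
have bf U W (vU : vector_field U) (vW : vector_field W) :=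
  vector_field_bracket vU vW.
have comm U W (vU : vector_field U) (vW : vector_field W) :
    mul_at a x (U a x) (W a x) = mul_at a x (W a x) (U a x) :=
  c_comm vU vW aA xa.
have assoc U V W (vU : vector_field U) (vV : vector_field V)
    (vW : vector_field W) :
    mul_at a x (U a x) (mul_at a x (V a x) (W a x)) =
    mul_at a x (mul_at a x (U a x) (V a x)) (W a x) :=
  c_assoc vU vV vW aA xa.
have HM : bracket (tprod c X Z) (tprod c Y Z) a x
    - mul_at a x (bracket (tprod c X Z) Y a x) (Z a x)
    - mul_at a x (bracket (tprod c X Z) Z a x) (Y a x)
    - mul_at a x (X a x) (bracket Z (tprod c Y Z) a x)
    + mul_at a x (mul_at a x (X a x) (bracket Z Y a x)) (Z a x)
    + mul_at a x (mul_at a x (X a x) (bracket Z Z a x)) (Y a x)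
    - mul_at a x (Z a x) (bracket X (tprod c Y Z) a x)
    + mul_at a x (mul_at a x (Z a x) (bracket X Y a x)) (Z a x)
    + mul_at a x (mul_at a x (Z a x) (bracket X Z a x)) (Y a x) = 0.
  exact (c_HM vX vZ vY vZ aA xa).
have -> : nijenhuis (mult_tensor c Z) X Y a x =
    bracket (tprod c X Z) (tprod c Y Z) a x
    - mul_at a x (bracket X (tprod c Y Z) a x) (Z a x)
    - mul_at a x (bracket (tprod c X Z) Y a x) (Z a x)
    + mul_at a x (mul_at a x (bracket X Y a x) (Z a x)) (Z a x).
  by rewrite /nijenhuis !app11_mult_tensor.
have -> : (tprod c X (defect Z Y) - tprod c Y (defect Z X)) a x =
    mul_at a x (X a x) (bracket Z (tprod c Y Z) a x
      - mul_at a x (bracket Z Y a x) (Z a x)) -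
    mul_at a x (Y a x) (bracket Z (tprod c X Z) a x
      - mul_at a x (bracket Z X a x) (Z a x)) by [].
have brC U W : bracket U W a x = 0 - bracket W U a x.
  by rewrite bracketC sub0r.
(* From here on every bracket that multiplies [Y] is written with [Z] on the
   left, as in [defect], and products are put in a normal form. *)
move: HM; rewrite bracketxx.
rewrite [bracket (tprod c X Z) Z a x]brC [bracket X Z a x]brC.
rewrite (comm _ _ vZ (bf _ _ vX vYZ)) (comm _ _ vZ (bf _ _ vX vY)).
rewrite !(mul_atBl, mul_atBr) !(mul_at0, mul_0at).
rewrite (assoc _ _ _ vX (bf _ _ vZ vY) vZ).
rewrite (comm _ _ (bf _ _ vZ vXZ) vY).
rewrite (comm _ _ vZ (bf _ _ vZ vX)).
rewrite [mul_at a x (mul_at a x (bracket Z X a x) (Z a x)) (Y a x)](comm _ _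
  (vector_field_tprod c_tensor (bf _ _ vZ vX) vZ) vY).
move: (bracket (tprod c X Z) (tprod c Y Z) a x) => A.
rewrite !tprodE.
do ![move: (mul_at a x _ _) => ?].
move=> /rowP HM; apply/rowP => i; move: (HM i).
by rewrite !mxE; lra.
Qed.

(** In [X o defect Z Y] a factor [Z] of [X] can be moved outside, so that the
    eight products obtained from the four Nijenhuis terms cancel in pairs. *)
Lemma haantjes_mult_tensor Z X Y :
  vector_field Z -> vector_field X -> vector_field Y ->
  field_eq (haantjes (mult_tensor c Z) X Y) 0.
Proof.
move=> vZ vX vY a aA x xa.
have vXZ := vector_field_tprod c_tensor vX vZ.
have vYZ := vector_field_tprod c_tensor vY vZ.
have nij U W (vU : vector_field U) (vW : vector_field W) :
    nijenhuis (mult_tensor c Z) U W a x =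
    mul_at a x (U a x) (defect Z W a x) - mul_at a x (W a x) (defect Z U a x) :=
  nijenhuis_mult_tensor vZ vU vW aA xa.
have ac U W (vU : vector_field U) (vW : vector_field W) :
    mul_at a x (mul_at a x (U a x) (Z a x)) (defect Z W a x) =
    mul_at a x (mul_at a x (U a x) (defect Z W a x)) (Z a x) :=
  tprodAC vU vZ (vector_field_defect vZ vW) aA xa.
have -> : haantjes (mult_tensor c Z) X Y a x =
    nijenhuis (mult_tensor c Z) (tprod c X Z) (tprod c Y Z) a x
    - mul_at a x (nijenhuis (mult_tensor c Z) X (tprod c Y Z) a x) (Z a x)
    - mul_at a x (nijenhuis (mult_tensor c Z) (tprod c X Z) Y a x) (Z a x)
    + mul_at a x (mul_at a x (nijenhuis (mult_tensor c Z) X Y a x) (Z a x))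
        (Z a x).
  by rewrite /haantjes !app11_mult_tensor.
rewrite !nij// !tprodE.
rewrite !mul_atBl !ac//.
do ![move: (mul_at a x _ _) => ?].
by apply/rowP => i; rewrite !mxE; ring.
Qed.

End Haantjes.

Theorem theorem1 (R : realType) (n : nat) (M : smooth_manifold R n)
    (c : field12 M) (c_tensor : tensor12 c)
    (c_comm : commutative_product c) (c_assoc : associative_product c)
    (c_HM : hertling_manin c)
    (Z : field10 M) (Z_field : vector_field Z)
    (X Y : field10 M) (X_field : vector_field X) (Y_field : vector_field Y) :
  field_eq (haantjes (mult_tensor c Z) X Y) 0%R.
Proof. exact: haantjes_mult_tensor. Qed.
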